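(* Let $0<\rho<\sigma<1$ and let $G_1,\dots,G_m:\mathbb{R}^n\to\mathcal{I}(\mathbb{R})$ be $gH$-continuously differentiable interval-valued maps. Let $(x^k),(d^k),(t_k),(\beta_k)$ be infinite sequences generated by the nonlinear conjugate gradient scheme described in the context, and let $L_0=\{x\in\mathbb{R}^n: G_i(x)\preceq G_i(x^0)\text{ for all }i=1,\dots,m\}$. Assume: (1) for each $i=1,\dots,m$, $\nabla_{gH}G_i$ is $gH$-Lipschitz continuous on $L_0$ with some constant $L_i$; (2) for every sequence $(y^k)$ in $L_0$ with $G_i(y^{k+1})\preceq G_i(y^k)$ for all $k$ and all $i=1,\dots,m$, there exist $\mathcal{G}_1,\dots,\mathcal{G}_m\in\mathcal{I}(\mathbb{R})$ such that $\mathcal{G}_i\preceq G_i(y^k)$ for all $k$ and all $i$; (3) $\displaystyle\sum_{k\ge0}\frac{1}{\|d^k\|^2}=+\infty$. Then: (i) If $d^k$ satisfies the sufficient descent condition (i.e. there is $c>0$ with $\psi\circ\phi_{x^k}(d^k)\le c\,\psi\circ\phi_{x^k}(v(x^k))$ for all $k\ge0$) and $t_k$ satisfies the standard Wolfe conditions for all $k$, then $\liminf_{k\to\infty}\|v(x^k)\|=0$. (ii) If $\beta_k\ge0$ for all $k$, $d^k$ is a descent direction for all $G_i$ at $x^k$ (i.e. $\psi\circ\phi_{x^k}(d^k)<0$) for all $k$, and $t_k$ satisfies the strong Wolfe conditions for all $k$, then $\liminf_{k\to\infty}\|v(x^k)\|=0$.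
   Context: $\|\cdot\|$ is the Euclidean norm. $\mathcal{I}(\mathbb{R})$ is the set of closed bounded intervals of $\mathbb{R}$. For $A=[a_1,a_2]$, $B=[b_1,b_2]$ in $\mathcal{I}(\mathbb{R})$ and $\alpha\in\mathbb{R}$: $A\oplus B=[a_1+b_1,a_2+b_2]$; $\alpha\odot A=A\odot\alpha=[\min\{\alpha a_1,\alpha a_2\},\max\{\alpha a_1,\alpha a_2\}]$; $A\preceq B$ means $a_1\le b_1$ and $a_2\le b_2$. Write $G_i=[\underline{G}_i,\overline{G}_i]$ with real-valued endpoint functions $\underline{G}_i\le\overline{G}_i$. ''$gH$-continuously differentiable'' means that the endpoint functions are differentiable and the $gH$-gradient $\nabla_{gH}G_i(x)$ is continuous in $x$, where $\nabla_{gH}G_i(x)$ is the vector of intervals whose $j$-th component is $[\underline{\nabla_{gH}G_i}(x)_j,\overline{\nabla_{gH}G_i}(x)_j]$ with $$\underline{\nabla_{gH}G_i}(x)_j=\min\{\partial_j\underline{G}_i(x),\partial_j\overline{G}_i(x)\},\qquad \overline{\nabla_{gH}G_i}(x)_j=\max\{\partial_j\underline{G}_i(x),\partial_j\overline{G}_i(x)\};$$ continuity means that the maps $\underline{\nabla_{gH}G_i},\overline{\nabla_{gH}G_i}:\mathbb{R}^n\to\mathbb{R}^n$ are continuous, and $gH$-Lipschitz continuity of $\nabla_{gH}G_i$ on $L_0$ with constant $L_i$ means that both of these maps are Lipschitz on $L_0$ with constant $L_i$ (Euclidean norm). For $x,v\in\mathbb{R}^n$, with $|v|=(|v_1|,\dots,|v_n|)^\top$,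 $$\psi\circ\phi_x(v):=\max_{1\le i\le m}\Big[\tfrac12\big(\underline{\nabla_{gH}G_i}(x)+\overline{\nabla_{gH}G_i}(x)\big)^\top v+\tfrac12\big(\overline{\nabla_{gH}G_i}(x)-\underline{\nabla_{gH}G_i}(x)\big)^\top|v|\Big].$$ For $x\in\mathbb{R}^n$, $v(x)$ is the unique minimizer and $\xi(x)$ the minimum value of the strongly convex function $v\mapsto\psi\circ\phi_x(v)+\tfrac12\|v\|^2$ over $\mathbb{R}^n$. Nonlinear conjugate gradient scheme: given $x^0\in\mathbb{R}^n$ and real parameters $\beta_k$ ($k\ge1$), $d^0=v(x^0)$, $d^k=v(x^k)+\beta_kd^{k-1}$ for $k\ge1$, and $x^{k+1}=x^k+t_kd^k$ with step lengths $t_k>0$. It is assumed throughout that the scheme produces infinite sequences with $\xi(x^k)\ne0$ and $v(x^k)\neq0$ for all $k$ (no stopping). Standard Wolfe conditions for $t_k$: $G_i(x^k+t_kd^k)\preceq G_i(x^k)\oplus[\rho t_k,\rho t_k]\odot\psi\circ\phi_{x^k}(d^k)$ for $i=1,\dots,m$, and $\psi\circ\phi_{x^k+t_kd^k}(d^k)\ge\sigma\,\psi\circ\phi_{x^k}(d^k)$. Strong Wolfe conditions for $t_k$: the same first condition, and $|\psi\circ\phi_{x^k+t_kd^k}(d^k)|\le\sigma\,|\psi\circ\phi_{x^k}(d^k)|$. *)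

(* Defs.v *)
From HB Require Import structures.
From mathcomp Require Import all_boot all_order all_algebra.
From mathcomp Require Import all_classical all_reals all_analysis.

Set Implicit Arguments.
Unset Strict Implicit.
Unset Printing Implicit Defensive.

Import Order.TTheory GRing.Theory Num.Theory.
Import numFieldNormedType.Exports.
Local Open Scope classical_set_scope.
Local Open Scope ring_scope.

Section Vectors.
Context {R : realType} {n : nat}.
Implicit Types u v : 'rV[R]_n.

Definition dotv u v : R := \sum_(j < n) u 0 j * v 0 j.

(* The library norm `|u| on 'rV[R]_n is the sup norm; it induces the same
   topology, but not the same Lipschitz constants, as the Euclidean norm. *)
Definition enorm u : R := Num.sqrt (dotv u u).

Definition absv u : 'rV[R]_n := map_mx Num.norm u.

Definition elipschitz_on (A : set 'rV[R]_n) (L : R)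
    (F : 'rV[R]_n -> 'rV[R]_n) : Prop :=
  forall x y, A x -> A y -> enorm (F x - F y) <= L * enorm (x - y).

End Vectors.

Section ClosedIntervals.
Context {R : realType}.

Record cintv := CIntv {
  ilo : R;
  ihi : R;
  ilo_le_ihi : ilo <= ihi }.

Implicit Types A B : cintv.

Lemma iadd_subproof A B : ilo A + ilo B <= ihi A + ihi B.
Proof. by rewrite lerD ?ilo_le_ihi. Qed.

Definition iadd A B : cintv := CIntv (iadd_subproof A B).

Lemma min_le_max_subproof (a b : R) : Num.min a b <= Num.max a b.
Proof. by rewrite ge_min !le_max lexx. Qed.

Definition ihull (a b : R) : cintv := CIntv (min_le_max_subproof a b).

Definition iscale (alpha : R) A : cintv :=
  ihull (alpha * ilo A) (alpha * ihi A).

Definition isingle (a : R) : cintv := CIntv (lexx a).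

Definition ile A B : Prop := ilo A <= ilo B /\ ihi A <= ihi B.

End ClosedIntervals.
Arguments cintv : clear implicits.

Section IntervalValuedMaps.
Context {R : realType} {n : nat}.
Implicit Types (g : 'rV[R]_n -> cintv R) (x : 'rV[R]_n).

Definition pderiv (f : 'rV[R]_n -> R) (x : 'rV[R]_n) (j : 'I_n) : R :=
  'D_(delta_mx 0 j) f x.

Definition gH_grad g x (j : 'I_n) : cintv R :=
  ihull (pderiv (ilo \o g) x j) (pderiv (ihi \o g) x j).

Definition gH_grad_lo g x : 'rV[R]_n := \row_j ilo (gH_grad g x j).
Definition gH_grad_hi g x : 'rV[R]_n := \row_j ihi (gH_grad g x j).

Definition gH_continuously_differentiable g : Prop :=
  [/\ forall x, differentiable (ilo \o g) x /\ differentiable (ihi \o g) x,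
      continuous (gH_grad_lo g) & continuous (gH_grad_hi g)].

Definition gH_grad_lipschitz_on (A : set 'rV[R]_n) (L : R) g : Prop :=
  elipschitz_on A L (gH_grad_lo g) /\ elipschitz_on A L (gH_grad_hi g).

End IntervalValuedMaps.

Section Objective.
(* Indexing by 'I_m.+1 encodes that there is at least one map, so that the
   maximum below ranges over a nonempty set. *)
Context {R : realType} {n m : nat}.
Variable G : 'I_m.+1 -> 'rV[R]_n -> cintv R.
Implicit Types x v : 'rV[R]_n.

Definition psiphi_term x v (i : 'I_m.+1) : R :=
  2^-1 * dotv (gH_grad_lo (G i) x + gH_grad_hi (G i) x) v
  + 2^-1 * dotv (gH_grad_hi (G i) x - gH_grad_lo (G i) x) (absv v).

Definition psiphi x v : R :=
  \big[Num.max/psiphi_term x v ord0]_(i < m.+1) psiphi_term x v i.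

Definition subproblem x v : R := psiphi x v + 2^-1 * enorm v ^+ 2.

(* [subproblem x] is strongly convex, hence has exactly one minimizer on R^n;
   the default value 0 of [xget] is never used. *)
Definition vdir x : 'rV[R]_n :=
  xget 0 [set v | forall w, subproblem x v <= subproblem x w].

Definition xi x : R := subproblem x (vdir x).

Definition level_set (x0 : 'rV[R]_n) : set 'rV[R]_n :=
  [set x | forall i, ile (G i x) (G i x0)].

(* beta 0 is not used. *)
Definition ncg_scheme (x d : nat -> 'rV[R]_n) (t beta : nat -> R) : Prop :=
  [/\ d 0%N = vdir (x 0%N),
      forall k, d k.+1 = vdir (x k.+1) + beta k.+1 *: d k,
      forall k, x k.+1 = x k + t k *: d k,
      forall k, 0 < t k &
      forall k, xi (x k) != 0 /\ vdir (x k) != 0].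

Definition armijo (rho : R) x d (t : R) : Prop :=
  forall i, ile (G i (x + t *: d))
                (iadd (G i x) (iscale (psiphi x d) (isingle (rho * t)))).

Definition standard_wolfe (rho sigma : R) x d (t : R) : Prop :=
  armijo rho x d t /\ sigma * psiphi x d <= psiphi (x + t *: d) d.

Definition strong_wolfe (rho sigma : R) x d (t : R) : Prop :=
  armijo rho x d t /\ `|psiphi (x + t *: d) d| <= sigma * `|psiphi x d|.

Definition sufficient_descent (x d : nat -> 'rV[R]_n) : Prop :=
  exists2 c : R, 0 < c &
    forall k, psiphi (x k) (d k) <= c * psiphi (x k) (vdir (x k)).

Definition lower_bounded_along_decreasing (A : set 'rV[R]_n) : Prop :=
  forall y : nat -> 'rV[R]_n,
    (forall k, A (y k)) ->
    (forall k i, ile (G i (y k.+1)) (G i (y k))) ->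
    exists B : 'I_m.+1 -> cintv R, forall k i, ile (B i) (G i (y k)).

End Objective.

(* Main.v *)
Require Import Defs.
From mathcomp Require Import all_boot all_order all_algebra.
From mathcomp Require Import all_classical all_reals all_analysis.
From mathcomp Require Import ring lra.

Set Implicit Arguments.
Unset Strict Implicit.
Unset Printing Implicit Defensive.

Import Order.TTheory GRing.Theory Num.Theory.
Import numFieldNormedType.Exports.
Local Open Scope classical_set_scope.
Local Open Scope ring_scope.

(** Why the theorem holds.  Write [p k := psiphi (x k) (d k)], which is
    negative in both parts.

    The curvature half of the Wolfe conditions makes [psiphi _ (d k)] increase
    by at least [(1 - sigma) * - p k] between [x k] and [x k.+1], while the
    Lipschitz hypothesis lets it increase by at most a constant times
    [t k * enorm (d k) ^+ 2] (lemma [psiphi_lipschitz]).  So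
    [p k ^+ 2 / enorm (d k) ^+ 2] is at most a constant times [t k * - p k],
    hence a constant times the decrease guaranteed by the Armijo half, and
    those decreases are summable because the endpoints are bounded below along
    the iterates.  This is the Zoutendijk condition (lemma [zoutendijk]).

    Now suppose that [enorm (vdir (x k))] stays above some [e > 0] from some
    rank on.  Comparing [vdir (x k)] with the competitor [0] in the subproblem
    gives [psiphi (x k) (vdir (x k)) <= - e ^+ 2 / 2].  In both parts this
    makes [(enorm (d k) ^+ 2)^-1] summable, against the hypothesis:
    - under sufficient descent [p k] is bounded away from 0, so the Zoutendijk
      condition already is a statement about [(enorm (d k) ^+ 2)^-1];
    - in the other part, sublinearity of [psiphi (x k)] and the strong Wolfe
      conditions yield
      [enorm (vdir (x k)) ^+ 2 / 2 <= - p k + beta k * - p k.-1], and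
      [beta k * enorm (d k.-1) <= enorm (d k) + enorm (vdir (x k))] by the
      recurrence for [d].  With [r k := - p k / enorm (d k)], which tends to 0
      by Zoutendijk, the resulting bound on [enorm (vdir (x k)) ^+ 2 / 2]
      (lemma [vdir_sqr_le]) has a part proportional to [enorm (vdir (x k))]
      that its left-hand side absorbs for large [k], leaving
      [e ^+ 2 / 4 <= (r k + r k.-1) * enorm (d k)].  So
      [(enorm (d k) ^+ 2)^-1] is at most a constant times
      [r k ^+ 2 + r k.-1 ^+ 2] (lemma [absorbed_inv_sqr_le]), and the squares
      [r k ^+ 2] are summable by Zoutendijk. *)

(** * Euclidean norm *)

Lemma dotvC (R : realType) (n : nat) (u v : 'rV[R]_n) : dotv u v = dotv v u.
Proof. by apply: eq_bigr => j _; rewrite mulrC. Qed.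

Lemma dotvDl (R : realType) (n : nat) (u v w : 'rV[R]_n) :
  dotv (u + v) w = dotv u w + dotv v w.
Proof. by rewrite -big_split; apply: eq_bigr => j _; rewrite mxE mulrDl. Qed.

Lemma dotvZl (R : realType) (n : nat) (a : R) (u w : 'rV[R]_n) :
  dotv (a *: u) w = a * dotv u w.
Proof.
by rewrite /dotv mulr_sumr; apply: eq_bigr => j _; rewrite mxE mulrA.
Qed.

Lemma dotvDr (R : realType) (n : nat) (u v w : 'rV[R]_n) :
  dotv w (u + v) = dotv w u + dotv w v.
Proof. by rewrite dotvC dotvDl !(dotvC w). Qed.

Lemma dotvZr (R : realType) (n : nat) (a : R) (u w : 'rV[R]_n) :
  dotv w (a *: u) = a * dotv w u.
Proof. by rewrite dotvC dotvZl (dotvC w). Qed.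

Lemma dotvNl (R : realType) (n : nat) (u w : 'rV[R]_n) :
  dotv (- u) w = - dotv u w.
Proof. by rewrite -scaleN1r dotvZl mulN1r. Qed.

Lemma dotvv_ge0 (R : realType) (n : nat) (u : 'rV[R]_n) : 0 <= dotv u u.
Proof. by apply: sumr_ge0 => j _; rewrite -expr2 sqr_ge0. Qed.

Lemma dotvv_eq0 (R : realType) (n : nat) (u : 'rV[R]_n) :
  dotv u u = 0 -> u = 0.
Proof.
move=> uu0; apply/rowP => j; rewrite mxE.
have sq_ge0 i : true -> 0 <= u 0 i * u 0 i by rewrite -expr2 sqr_ge0.
have /eqP := psumr_eq0P sq_ge0 uu0 (i := j) isT.
by rewrite mulf_eq0 orbb => /eqP.
Qed.

Lemma sqr_enorm (R : realType) (n : nat) (u : 'rV[R]_n) :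
  enorm u ^+ 2 = dotv u u.
Proof. by rewrite sqr_sqrtr // dotvv_ge0. Qed.

Lemma enorm_ge0 (R : realType) (n : nat) (u : 'rV[R]_n) : 0 <= enorm u.
Proof. exact: sqrtr_ge0. Qed.

Lemma enorm_gt0 (R : realType) (n : nat) (u : 'rV[R]_n) :
  u != 0 -> 0 < enorm u.
Proof.
move=> u0; rewrite lt_neqAle enorm_ge0 andbT eq_sym.
apply: contra u0 => /eqP nu0; apply/eqP/dotvv_eq0.
by rewrite -sqr_enorm nu0 expr0n.
Qed.

Lemma enormZ (R : realType) (n : nat) (a : R) (u : 'rV[R]_n) :
  enorm (a *: u) = `|a| * enorm u.
Proof.
rewrite /enorm dotvZl dotvZr mulrA -expr2 sqrtrM ?sqr_ge0 //.
by rewrite sqrtr_sqr.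
Qed.

Lemma enorm_absv (R : realType) (n : nat) (u : 'rV[R]_n) :
  enorm (absv u) = enorm u.
Proof.
congr Num.sqrt; apply: eq_bigr => j _.
by rewrite mxE -normrM ger0_norm // -expr2 sqr_ge0.
Qed.

(** Cauchy-Schwarz inequality, from the positivity of the squared norm of
    [dotv v v *: u - dotv u v *: v]. *)
Lemma sqr_dotv_le (R : realType) (n : nat) (u v : 'rV[R]_n) :
  dotv u v ^+ 2 <= dotv u u * dotv v v.
Proof.
have [vv0|vv_neq0] := eqVneq (dotv v v) 0.
  rewrite (dotvv_eq0 vv0) -(scale0r (0 : 'rV_n)) !dotvZr.
  by rewrite !mul0r mulr0 expr0n.
have vv_gt0 : 0 < dotv v v by rewrite lt_neqAle eq_sym vv_neq0 dotvv_ge0.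
have := dotvv_ge0 (dotv v v *: u + (- dotv u v) *: v).
rewrite !(dotvDl, dotvDr, dotvZl, dotvZr) (dotvC v u).
set A := dotv u u; set B := dotv v v; set C := dotv u v.
rewrite (_ : _ + _ = B * (A * B - C ^+ 2)); last by ring.
by rewrite pmulr_rge0 // subr_ge0.
Qed.

Lemma dotv_le_enorm (R : realType) (n : nat) (u v : 'rV[R]_n) :
  dotv u v <= enorm u * enorm v.
Proof.
rewrite -sqrtrM ?dotvv_ge0 // (le_trans (ler_norm _)) // -sqrtr_sqr.
by rewrite ler_wsqrtr // sqr_dotv_le.
Qed.

Lemma enormD (R : realType) (n : nat) (u v : 'rV[R]_n) :
  enorm (u + v) <= enorm u + enorm v.
Proof.
rewrite -(@ler_pXn2r _ 2) ?nnegrE ?addr_ge0 ?enorm_ge0 //.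
rewrite sqrrD !sqr_enorm dotvDl !dotvDr (dotvC v u).
have := dotv_le_enorm u v; lra.
Qed.

Lemma enormN (R : realType) (n : nat) (u : 'rV[R]_n) : enorm (- u) = enorm u.
Proof. by rewrite -scaleN1r enormZ normrN1 mul1r. Qed.

(** * Sublinearity and Lipschitz dependence of the descent function *)

Lemma psiphi_ge_term (R : realType) (n m : nat)
    (G : 'I_m.+1 -> 'rV[R]_n -> cintv R) (y v : 'rV[R]_n) (i : 'I_m.+1) :
  psiphi_term G y v i <= psiphi G y v.
Proof. exact: le_bigmax. Qed.

Lemma psiphi_le (R : realType) (n m : nat)
    (G : 'I_m.+1 -> 'rV[R]_n -> cintv R) (y v : 'rV[R]_n) (a : R) :
  (forall i, psiphi_term G y v i <= a) -> psiphi G y v <= a.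
Proof. by move=> le_a; apply: bigmax_le => // i _; exact: le_a. Qed.

(** The coefficient of [absv v] in each term is the vector of widths of the
    gH-gradient; its nonnegativity is what makes the term convex in [v]. *)
Lemma gH_grad_width_ge0 (R : realType) (n : nat) (g : 'rV[R]_n -> cintv R)
    (y : 'rV[R]_n) (j : 'I_n) : 0 <= (gH_grad_hi g y - gH_grad_lo g y) 0 j.
Proof. by rewrite !mxE subr_ge0; exact: (ilo_le_ihi (gH_grad g y j)). Qed.

(** Each term is linear in [v] plus a nonnegative combination of the absolute
    values of the components of [v], and a maximum of sublinear functions is
    sublinear. *)
Lemma psiphiDZ_le (R : realType) (n m : nat)
    (G : 'I_m.+1 -> 'rV[R]_n -> cintv R) (y u w : 'rV[R]_n) (b : R) :
  0 <= b -> psiphi G y (u + b *: w) <= psiphi G y u + b * psiphi G y w.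
Proof.
move=> b_ge0; apply: psiphi_le => i.
apply: (@le_trans _ _ (psiphi_term G y u i + b * psiphi_term G y w i));
  last first.
  by rewrite lerD ?ler_wpM2l ?psiphi_ge_term.
rewrite /psiphi_term dotvDr dotvZr.
set g := _ - _.
suff : dotv g (absv (u + b *: w)) <= dotv g (absv u) + b * dotv g (absv w).
  by nra.
rewrite -dotvZr -dotvDr; apply: ler_sum => j _.
rewrite ler_wpM2l ?gH_grad_width_ge0 // !mxE.
by rewrite (le_trans (ler_normD _ _)) // normrM (ger0_norm b_ge0).
Qed.

Lemma psiphi0 (R : realType) (n m : nat)
    (G : 'I_m.+1 -> 'rV[R]_n -> cintv R) (y : 'rV[R]_n) : psiphi G y 0 = 0.
Proof.
have term0 i : psiphi_term G y 0 i = 0.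
  have absv0 : absv (0 : 'rV[R]_n) = 0.
    by apply/rowP => j; rewrite !mxE normr0.
  rewrite /psiphi_term absv0 -(scale0r (0 : 'rV_n)) !dotvZr.
  by rewrite !mul0r !mulr0 addr0.
apply/eqP; rewrite eq_le psiphi_le => [|i]; last by rewrite term0.
by rewrite -{1}(term0 ord0) psiphi_ge_term.
Qed.

Lemma enorm_descent_gt0 (R : realType) (n m : nat)
    (G : 'I_m.+1 -> 'rV[R]_n -> cintv R) (y v : 'rV[R]_n) :
  psiphi G y v < 0 -> 0 < enorm v.
Proof.
move=> psi_lt0; apply: enorm_gt0; apply: contraTneq psi_lt0 => ->.
by rewrite psiphi0 ltxx.
Qed.

(** In the point, only the two endpoint gradients vary.  By Cauchy-Schwarz the
    variation of either one is paired once with [v] and once with [absv v],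
    which have the same norm, each time with coefficient one half; hence twice
    a common Lipschitz constant of the endpoint gradients is enough. *)
Lemma psiphi_lipschitz (R : realType) (n m : nat)
    (G : 'I_m.+1 -> 'rV[R]_n -> cintv R) (A : set 'rV[R]_n) :
  (forall i, exists L : R, gH_grad_lipschitz_on A L (G i)) ->
  exists2 L : R, 0 < L &
    forall y z v, A y -> A z ->
      psiphi G y v <= psiphi G z v + L * enorm (y - z) * enorm v.
Proof.
move=> /choice[L lipL].
pose M := 1 + \sum_i `|L i|.
have M_gt0 : 0 < M by rewrite ltr_pwDl // sumr_ge0.
have L_le i : L i <= M.
  rewrite (le_trans (ler_norm _)) // /M (bigD1 i) //=.
  by rewrite addrCA lerDl addr_ge0 ?sumr_ge0.
exists (2 * M); first by rewrite mulr_gt0.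
move=> y z v Ay Az; apply: psiphi_le => i.
rewrite -(lerD2r (- psiphi_term G z v i)).
apply: (@le_trans _ _ (2 * M * enorm (y - z) * enorm v)); last first.
  by rewrite addrAC lerDr subr_ge0 psiphi_ge_term.
have [lip_lo lip_hi] := lipL i.
have {lip_lo} : enorm (gH_grad_lo (G i) y - gH_grad_lo (G i) z)
    <= M * enorm (y - z).
  by rewrite (le_trans (lip_lo _ _ Ay Az)) // ler_wpM2r ?enorm_ge0.
have {lip_hi} : enorm (gH_grad_hi (G i) y - gH_grad_hi (G i) z)
    <= M * enorm (y - z).
  by rewrite (le_trans (lip_hi _ _ Ay Az)) // ler_wpM2r ?enorm_ge0.
rewrite /psiphi_term.
move: (gH_grad_lo _ y) (gH_grad_lo _ z) => ly lz.
move: (gH_grad_hi _ y) (gH_grad_hi _ z) => hy hz.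
have v_ge0 := enorm_ge0 v.
move=> /(ler_wpM2r v_ge0) hi_le /(ler_wpM2r v_ge0) lo_le.
move: (dotv_le_enorm (ly - lz) v) (dotv_le_enorm (hy - hz) v).
move: (dotv_le_enorm (hy - hz) (absv v)).
move: (dotv_le_enorm (- (ly - lz)) (absv v)).
rewrite enormN !enorm_absv !(dotvDl, dotvNl).
move: hi_le lo_le; clear.
move: (enorm (ly - lz)) (enorm (hy - hz)) (enorm (y - z)) (enorm v).
move: (dotv ly v) (dotv lz v) (dotv hy v) (dotv hz v).
move: (dotv ly _) (dotv lz _) (dotv hy _) (dotv hz _).
by move=> *; lra.
Qed.

(** Half of the exact identity [psiphi y (vdir y) = - enorm (vdir y) ^+ 2],
    obtained by testing the minimality of [vdir y] against [0] only.  Since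
    [vdir y] falls back to [0] when no minimizer exists, [vdir y != 0] ensures
    that it is one. *)
Lemma psiphi_vdir_le (R : realType) (n m : nat)
    (G : 'I_m.+1 -> 'rV[R]_n -> cintv R) (y : 'rV[R]_n) :
  vdir G y != 0 -> psiphi G y (vdir G y) <= - (enorm (vdir G y) ^+ 2 / 2).
Proof.
move=> v_neq0.
have v_min w : subproblem G y (vdir G y) <= subproblem G y w.
  by move: v_neq0; rewrite /vdir; case: xgetP => [v -> ->|_]; rewrite ?eqxx.
have enorm0 : enorm (0 : 'rV[R]_n) = 0.
  by rewrite -(scale0r (0 : 'rV_n)) enormZ normr0 mul0r.
have := v_min 0; rewrite /subproblem psiphi0 enorm0.
lra.
Qed.

(** * Series with nonnegative terms, and lower limits *)

Lemma series_le_cvg_near (R : realType) (u v : nat -> R) :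
  (forall k, 0 <= u k) -> (forall k, 0 <= v k) ->
  (\forall k \near \oo, u k <= v k) ->
  cvgn (series v) -> cvgn (series u).
Proof.
move=> u_ge0 v_ge0 [N _ uv] cv.
(* A sequence with finite support corrects the terms of rank below N. *)
pose w k := if (k < N)%N then u k else 0.
have w_ge0 k : 0 <= w k by rewrite /w; case: ifP.
have cw : cvgn (series w).
  rewrite -(is_cvg_series_restrict N) (_ : (fun n => _) = cst 0).
    exact: is_cvg_cst.
  apply/funext => k /=; rewrite big_nat_cond big1 // => j.
  by case/andP=> /andP[Nj _] _; rewrite /w ltnNge Nj.
apply: (series_le_cvg u_ge0 _ _ (is_cvg_seriesD cv cw)) => k.
  exact: addr_ge0.
rewrite /GRing.add /= /w; case: ltnP => [_|Nk]; first by rewrite lerDr.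
by rewrite addr0; exact: uv.
Qed.

Lemma is_cvg_series_predn (R : realType) (u : nat -> R) :
  cvgn (series u) -> cvgn (series (fun k => u k.-1)).
Proof.
move=> /cvg_ex[l ul]; apply/cvg_ex; exists (u 0%N + l).
rewrite -cvg_shiftS.
rewrite (_ : [sequence _]_n = (fun k => u 0%N + series u k)).
  by apply: cvgD => //; exact: cvg_cst.
by apply/funext => k; rewrite /series /= big_nat_recl.
Qed.

Lemma cvg_series_nneseries_neqy (R : realType) (u : nat -> R) :
  cvgn (series u) -> (\sum_(0 <= k <oo) (u k)%:E)%E <> +oo%E.
Proof.
move=> cu; under eq_fun do rewrite sumEFin.
by rewrite (EFin_lim cu).
Qed.

(** All the infima of tails, whose limit is the lower limit, vanish. *)
Lemma limn_einf_eq0 (R : realType) (u : nat -> R) :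
  (forall k, 0 <= u k) ->
  (forall N e, 0 < e -> exists2 k, (N <= k)%N & u k < e) ->
  limn_einf (fun k => (u k)%:E) = 0%E.
Proof.
move=> u_ge0 u_small; rewrite limn_einf_lim.
rewrite (_ : einfs _ = cst 0%E); first exact: lim_cst.
apply/funext => N; apply/eqP; rewrite eq_le; apply/andP; split.
  apply/lee_addgt0Pr => e e_gt0; rewrite add0e.
  have [k Nk uk] := u_small N e e_gt0.
  apply: (@le_trans _ _ (u k)%:E); last by rewrite lee_fin ltW.
  by apply: ereal_inf_lbound; exists k.
by apply: le_ereal_inf_tmp => _ [k _ <-]; rewrite lee_fin.
Qed.

(** * The Zoutendijk condition *)

(** The interval scaled in the Armijo condition is degenerate, so both endpoints
    of the map satisfy the scalar Armijo inequality. *)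
Lemma armijoP (R : realType) (n m : nat)
    (G : 'I_m.+1 -> 'rV[R]_n -> cintv R) (rho : R) (y v : 'rV[R]_n) (s : R)
    (i : 'I_m.+1) :
  armijo G rho y v s ->
  ilo (G i (y + s *: v)) <= ilo (G i y) + rho * s * psiphi G y v /\
  ihi (G i (y + s *: v)) <= ihi (G i y) + rho * s * psiphi G y v.
Proof. by move=> /(_ i)[/=]; rewrite minxx maxxx (mulrC (psiphi _ _ _)). Qed.

(** The curvature and Lipschitz estimates bound [t k] from below by
    [(1 - sigma) * - p k / (L * enorm (d k) ^+ 2)]; multiplying by [- p k]
    compares the general term with the summable Armijo decrease. *)
Lemma zoutendijk (R : realType) (n m : nat) (rho sigma : R)
    (G : 'I_m.+1 -> 'rV[R]_n -> cintv R)
    (x d : nat -> 'rV[R]_n) (t : nat -> R) :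
  0 < rho -> sigma < 1 ->
  (forall k, x k.+1 = x k + t k *: d k) -> (forall k, 0 < t k) ->
  (forall i, exists L : R,
     gH_grad_lipschitz_on (level_set G (x 0%N)) L (G i)) ->
  lower_bounded_along_decreasing G (level_set G (x 0%N)) ->
  (forall k, psiphi G (x k) (d k) < 0) ->
  (forall k, standard_wolfe G rho sigma (x k) (d k) (t k)) ->
  cvgn (series (fun k => psiphi G (x k) (d k) ^+ 2 / enorm (d k) ^+ 2)).
Proof.
move=> rho_gt0 sigma_lt1 xS t_gt0 G_lip G_bounded p_lt0 wolfe.
pose p k := psiphi G (x k) (d k).
pose decr k := t k * - p k.
have decr_ge0 k : 0 <= decr k by apply: mulr_ge0; rewrite ?oppr_ge0 ltW // /p.
have armijo_decr k i :
    ilo (G i (x k.+1)) <= ilo (G i (x k)) - rho * decr k /\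
    ihi (G i (x k.+1)) <= ihi (G i (x k)) - rho * decr k.
  have [/(armijoP i) + _] := wolfe k.
  by rewrite -xS /decr mulrN mulrN opprK mulrA.
have G_decr k i : ile (G i (x k.+1)) (G i (x k)).
  have rd : 0 <= rho * decr k by rewrite mulr_ge0 // ltW.
  by have [lo hi] := armijo_decr k i; split; lra.
have x_level k : level_set G (x 0%N) (x k).
  elim: k => [|k IHk] i; first by split.
  have [lo hi] := G_decr k i; have [lo0 hi0] := IHk i.
  by split; [exact: le_trans lo0 | exact: le_trans hi0].
have [L L_gt0 lip] := psiphi_lipschitz G_lip.
have cvg_decr : cvgn (series decr).
  (* One endpoint of one component suffices: it drops by at least
     rho * decr k at step k and is bounded below. *)
  have [B B_le] := G_bounded x x_level G_decr.
  apply: nondecreasing_is_cvgn; first exact: nondecreasing_series.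
  exists ((ilo (G ord0 (x 0%N)) - ilo (B ord0)) / rho) => _ [N _ <-].
  have [lo _] := B_le N ord0.
  rewrite ler_pdivlMr // lerBrDr -lerBrDl; apply: le_trans lo _.
  elim: N => [|N IHN]; first by rewrite /series /= big_geq // mul0r subr0.
  rewrite seriesSr /=.
  have [lo _] := armijo_decr N ord0; lra.
have cvg_bound : cvgn (series (fun k => L / (1 - sigma) * decr k)).
  exact: is_cvg_seriesZ.
apply: series_le_cvg cvg_bound => k.
- by rewrite divr_ge0 ?sqr_ge0.
- by rewrite mulr_ge0 // divr_ge0 // ?subr_ge0 ltW.
have d_gt0 := enorm_descent_gt0 (p_lt0 k).
have [_ curv] := wolfe k; rewrite -xS in curv.
have := lip _ _ (d k) (x_level k.+1) (x_level k).
rewrite xS addrAC subrr add0r enormZ gtr0_norm // -xS => incr.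
have step : (1 - sigma) * - p k <= L * t k * enorm (d k) ^+ 2.
  move: curv incr; rewrite -/(p k); clear.
  move: (psiphi _ _ _) (p k) (enorm _) => *; lra.
rewrite ler_pdivrMr ?exprn_gt0 //.
rewrite [leRHS](_ : _ = L * decr k * enorm (d k) ^+ 2 / (1 - sigma));
  last first.
  by rewrite (mulrAC L) (mulrAC (L * _)).
rewrite ler_pdivlMr ?subr_gt0 //.
have := ler_wpM2r (_ : 0 <= - p k) step.
rewrite oppr_ge0 ltW ?p_lt0 // => /(_ isT).
rewrite -/(p k) /decr; clear; by move: (p k) (enorm _) => *; lra.
Qed.

Lemma strong_wolfe_standard (R : realType) (n m : nat)
    (G : 'I_m.+1 -> 'rV[R]_n -> cintv R) (rho sigma : R) (y v : 'rV[R]_n)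
    (s : R) :
  psiphi G y v < 0 ->
  strong_wolfe G rho sigma y v s -> standard_wolfe G rho sigma y v s.
Proof.
move=> p_lt0 [arm curv]; split=> //; move: p_lt0 curv; clear.
move: (psiphi G y v) (psiphi _ _ _) => p q p_lt0.
by rewrite (ltr0_norm p_lt0) ler_norml => /andP[]; rewrite mulrN opprK.
Qed.

Lemma strong_wolfe_upper (R : realType) (n m : nat)
    (G : 'I_m.+1 -> 'rV[R]_n -> cintv R) (rho sigma : R) (y v : 'rV[R]_n)
    (s : R) :
  psiphi G y v < 0 -> strong_wolfe G rho sigma y v s ->
  psiphi G (y + s *: v) v <= sigma * - psiphi G y v.
Proof.
move=> p_lt0 [_ curv]; move: p_lt0 curv; clear.
move: (psiphi G y v) (psiphi _ _ _) => p q p_lt0.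
by rewrite (ltr0_norm p_lt0); exact: le_trans (ler_norm _).
Qed.

(** * The key estimate under the strong Wolfe conditions *)

(** Sublinearity bounds [psiphi G y' d'] by values at [vdir G y'] and at the
    previous direction [d].  The curvature condition turns the latter into
    [b * - psiphi G y d], in which writing [- psiphi G y d] as a multiple of
    [enorm d] makes [b] appear only in [b * enorm d]; the triangle inequality
    for [b *: d = d' - vdir G y'] then eliminates it. *)
Lemma vdir_sqr_le (R : realType) (n m : nat)
    (G : 'I_m.+1 -> 'rV[R]_n -> cintv R) (sigma b : R)
    (y y' d d' : 'rV[R]_n) :
  0 <= b -> sigma < 1 -> vdir G y' != 0 -> d' = vdir G y' + b *: d ->
  psiphi G y d < 0 -> psiphi G y' d <= sigma * - psiphi G y d ->
  psiphi G y' d' < 0 ->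
  enorm (vdir G y') ^+ 2 / 2 <=
    (- psiphi G y' d' / enorm d' + - psiphi G y d / enorm d) * enorm d'
    + - psiphi G y d / enorm d * enorm (vdir G y').
Proof.
move=> b_ge0 sigma_lt1 v_neq0 d'E p_lt0 curv p'_lt0.
have d_gt0 := enorm_descent_gt0 p_lt0.
have d'_gt0 := enorm_descent_gt0 p'_lt0.
rewrite mulrDl divfK ?gt_eqF // -addrA -mulrDr.
set r := _ / enorm d.
have rd : r * enorm d = - psiphi G y d by rewrite divfK ?gt_eqF.
have r_ge0 : 0 <= r by rewrite divr_ge0 ?enorm_ge0 // oppr_ge0 ltW.
have bd_le : b * enorm d <= enorm d' + enorm (vdir G y').
  rewrite -{1}(ger0_norm b_ge0) -enormZ.
  rewrite (_ : b *: d = d' + - vdir G y').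
    by rewrite (le_trans (enormD _ _)) // enormN.
  by rewrite d'E addrAC subrr add0r.
have := psiphiDZ_le G y' (vdir G y') d b_ge0; rewrite -d'E.
have := psiphi_vdir_le v_neq0.
have := ler_wpM2l r_ge0 bd_le.
have : b * psiphi G y' d <= b * - psiphi G y d.
  rewrite ler_wpM2l // (le_trans curv) // ler_piMl ?ltW //.
  by rewrite oppr_gt0.
rewrite -rd; clear.
move: (psiphi G y' d) (psiphi G y' d') (psiphi G y' _) (enorm d') (enorm d) r.
by move: (enorm _) => *; lra.
Qed.

(** Once [r0] is below [e / 4], the summand [r0 * v] costs at most half of
    [v ^+ 2 / 2], hence [e ^+ 2 / 4 <= (r1 + r0) * D]; the factor 2 comes from
    [(r1 + r0) ^+ 2 <= 2 * (r1 ^+ 2 + r0 ^+ 2)]. *)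
Lemma absorbed_inv_sqr_le (R : realType) (e v D r0 r1 : R) :
  0 < e -> 0 <= r0 -> 0 <= r1 -> 0 < D -> e <= v -> r0 <= e / 4 ->
  v ^+ 2 / 2 <= (r1 + r0) * D + r0 * v ->
  (D ^+ 2)^-1 <= 2 * (4 / e ^+ 2) ^+ 2 * (r1 ^+ 2 + r0 ^+ 2).
Proof.
move=> e_gt0 r0_ge0 r1_ge0 D_gt0 e_le_v r0_small est.
have absorbed : e ^+ 2 / 4 <= (r1 + r0) * D by nra.
have inv_le : D^-1 <= 4 / e ^+ 2 * (r1 + r0).
  rewrite mulrAC ler_pdivlMr ?exprn_gt0 // mulrC ler_pdivrMr //.
  by lra.
rewrite -exprVn (@le_trans _ _ ((4 / e ^+ 2 * (r1 + r0)) ^+ 2)) //.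
  by rewrite ler_sqr ?nnegrE ?(le_trans _ inv_le) ?invr_ge0 ?(ltW D_gt0).
have := sqr_ge0 (4 / e ^+ 2); rewrite exprMn.
move: ((4 / e ^+ 2) ^+ 2) => A A_ge0.
by have := sqr_ge0 (r1 - r0); nra.
Qed.

(** * Convergence *)

Theorem theorem4p1 (R : realType) (n m : nat) (rho sigma : R)
    (G : 'I_m.+1 -> 'rV[R]_n -> cintv R)
    (x d : nat -> 'rV[R]_n) (t beta : nat -> R)
    (rho_gt0 : 0 < rho) (rho_lt_sigma : rho < sigma) (sigma_lt1 : sigma < 1)
    (G_diff : forall i, gH_continuously_differentiable (G i))
    (scheme : ncg_scheme G x d t beta)
    (G_lip : forall i, exists L : R,
       gH_grad_lipschitz_on (level_set G (x 0%N)) L (G i))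
    (G_bounded : lower_bounded_along_decreasing G (level_set G (x 0%N)))
    (d_series : (\sum_(0 <= k <oo) ((enorm (d k) ^+ 2)^-1)%:E = +oo)%E) :
  (sufficient_descent G x d ->
   (forall k, standard_wolfe G rho sigma (x k) (d k) (t k)) ->
   limn_einf (fun k => (enorm (vdir G (x k)))%:E) = 0%E)
  /\
  ((forall k, (1 <= k)%N -> 0 <= beta k) ->
   (forall k, psiphi G (x k) (d k) < 0) ->
   (forall k, strong_wolfe G rho sigma (x k) (d k) (t k)) ->
   limn_einf (fun k => (enorm (vdir G (x k)))%:E) = 0%E).
Proof.
have [_ dS xS t_gt0 nonstop] := scheme.
have v_neq0 k : vdir G (x k) != 0 by have [] := nonstop k.
pose p k := psiphi G (x k) (d k).
pose zou k := p k ^+ 2 / enorm (d k) ^+ 2.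
have zou_ge0 k : 0 <= zou k by rewrite divr_ge0 ?sqr_ge0.
(* A nonzero lower limit keeps the norms of the directions [vdir G (x k)] above
   some e; each part then has to supply a convergent majorant of the series. *)
have reduction : (forall N e, 0 < e ->
    (forall k, (N <= k)%N -> e <= enorm (vdir G (x k))) ->
    exists2 u : nat -> R, cvgn (series u) &
      (forall k, 0 <= u k) /\
      \forall k \near \oo, (enorm (d k) ^+ 2)^-1 <= u k) ->
    limn_einf (fun k => (enorm (vdir G (x k)))%:E) = 0%E.
  move=> bound; apply: limn_einf_eq0 => [k|N e e_gt0]; first exact: enorm_ge0.
  apply: contrapT => far.
  have v_ge k : (N <= k)%N -> e <= enorm (vdir G (x k)).
    by move=> Nk; rewrite leNgt; apply/negP => v_lt; apply: far; exists k.
  have [u cu [u_ge0 le_u]] := bound N e e_gt0 v_ge.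
  apply: (@cvg_series_nneseries_neqy _ _ _ d_series).
  apply: series_le_cvg_near u_ge0 le_u cu => k.
  by rewrite invr_ge0 sqr_ge0.
split=> [[c c_gt0 descent] wolfe|beta_ge0 p_lt0 swolfe].
- have p_le k : p k <= - (c * (enorm (vdir G (x k)) ^+ 2 / 2)).
    rewrite (le_trans (descent k)) // -mulrN ler_wpM2l ?(ltW c_gt0) //.
    exact: psiphi_vdir_le.
  have p_lt0 k : p k < 0.
    rewrite (le_lt_trans (p_le k)) // oppr_lt0 mulr_gt0 // divr_gt0 //.
    by rewrite exprn_gt0 // enorm_gt0.
  have zou_cvg := zoutendijk rho_gt0 sigma_lt1 xS t_gt0
    G_lip G_bounded p_lt0 wolfe.
  apply: reduction => N e e_gt0 v_ge.
  pose a := c * (e ^+ 2 / 2).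
  have a_gt0 : 0 < a by rewrite mulr_gt0 // divr_gt0 ?exprn_gt0.
  exists (fun k => (a ^+ 2)^-1 * zou k); first exact: is_cvg_seriesZ.
  split=> [k|]; first by rewrite mulr_ge0 ?invr_ge0 ?sqr_ge0.
  exists N => // k /= Nk.
  rewrite /zou mulrA ler_peMl ?invr_ge0 ?sqr_ge0 //.
  rewrite mulrC ler_pdivlMr ?exprn_gt0 // mul1r -[leRHS]sqrrN.
  rewrite ler_sqr ?nnegrE ?oppr_ge0 ?(ltW a_gt0) ?(ltW (p_lt0 k)) //.
  rewrite lerNr (le_trans (p_le k)) //.
  rewrite lerN2 ler_wpM2l ?(ltW c_gt0) // ler_wpM2r ?invr_ge0 //.
  by rewrite ler_pXn2r ?nnegrE ?enorm_ge0 ?v_ge // ltW.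
- have zou_cvg : cvgn (series zou).
    apply: (zoutendijk rho_gt0 sigma_lt1 xS t_gt0
      G_lip G_bounded p_lt0) => k.
    exact: strong_wolfe_standard.
  apply: reduction => N e e_gt0 v_ge.
  pose r k := - p k / enorm (d k).
  have r_ge0 k : 0 <= r k by rewrite divr_ge0 ?enorm_ge0 // oppr_ge0 ltW // /p.
  have zouE k : zou k = r k ^+ 2 by rewrite /r expr_div_n sqrrN.
  pose C := 2 * (4 / e ^+ 2) ^+ 2.
  exists (fun k => C * (zou k + zou k.-1)).
    apply: (@is_cvg_seriesZ _ (fun k => zou k + zou k.-1)).
    apply: (is_cvg_seriesD zou_cvg); exact: is_cvg_series_predn.
  have C_ge0 : 0 <= C by rewrite mulr_ge0 ?sqr_ge0.
  split=> [k|]; first by rewrite mulr_ge0 ?addr_ge0.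
  have [M _ r_small] : \forall k \near \oo, r k <= e / 4.
    have /cvgr0Pnorm_le /(_ ((e / 4) ^+ 2)) := cvg_series_cvg_0 zou_cvg.
    rewrite exprn_gt0 ?divr_gt0 // => /(_ isT).
    apply: filterS => k; rewrite ger0_norm // zouE.
    by rewrite ler_pXn2r ?nnegrE // divr_ge0 ?(ltW e_gt0).
  exists (maxn N M).+1 => // -[//|k] /=; rewrite ltnS geq_max => /andP[Nk Mk].
  have curv := strong_wolfe_upper (p_lt0 k) (swolfe k); rewrite -xS in curv.
  have := vdir_sqr_le (beta_ge0 k.+1 isT) sigma_lt1
    (v_neq0 k.+1) (dS k) (p_lt0 k) curv (p_lt0 k.+1).
  rewrite -!/(p _) -!/(r _).
  have d_gt0 := enorm_descent_gt0 (p_lt0 k.+1).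
  have v_ge_e := v_ge k.+1 (leqW Nk).
  have rk_small := r_small k Mk.
  rewrite !zouE.
  exact: absorbed_inv_sqr_le
    e_gt0 (r_ge0 k) (r_ge0 k.+1) d_gt0 v_ge_e rk_small.
Qed.
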